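(* For every $n \ge 1$, every shortcutting with hop-diameter $k$ of an $n$-point path must have treewidth (i) $\Omega(k\log^{2/k} n)$ for even $k$ and $\Omega\!\left(k\left(\frac{\log n}{\log\log n}\right)^{2/(k-1)}\right)$ for odd $k\ge 3$, whenever $k \le \frac{2}{\ln(2e)}\ln\log n$; (ii) $\Omega((\log\log n)^2/k)$ whenever $k > \frac{2}{\ln(2e)}\ln\log n$.
   Context: Let $T=(V,E)$ be a tree (here a path, e.g. on the points $1,\dots,n$ of the line with unit edge lengths) and $d_T$ its shortest-path metric. A shortcutting of $T$ with hop-diameter $k$ is a graph $G=(V,E')$, where each edge $(x,y)\in E'$ has length $d_T(x,y)$, such that for every $u,v\in V$ there is a path in $G$ between $u$ and $v$ with at most $k$ edges whose length equals $d_T(u,v)$. Logarithms $\log$ are base 2. *)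

(* Defs.v *)
From HB Require Import structures.
From mathcomp Require Import all_boot all_order all_algebra.
From mathcomp Require Import all_classical all_reals exp.

Set Implicit Arguments.
Unset Strict Implicit.
Unset Printing Implicit Defensive.
Import Order.TTheory GRing.Theory Num.Theory.
Local Open Scope ring_scope.

Section Graphs.
Variable V : finType.
Implicit Types (e : rel V) (u v : V).

Definition simple_graph e : Prop := symmetric e /\ irreflexive e.

(* The vertex sequence of the path is [u :: p], so [size p] is its number of
   edges. *)
Definition simple_path e u v (p : seq V) : bool :=
  [&& path e u p, last u p == v & uniq (u :: p)].

(* A two-vertex [c] satisfies [ucycle e c] as soon as its vertices are
   adjacent, so that genuine cycles are those with at least three vertices. *)
Definition acyclic e : Prop := forall c : seq V, ucycle e c -> (size c <= 2)%N.

Definition tree e : Prop :=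
  [/\ (0 < #|V|)%N, simple_graph e, forall u v, connect e u v & acyclic e].

End Graphs.

Section Treewidth.
Variables (V : finType) (G : rel V).

Definition tree_decomposition (I : finType) (F : rel I) (B : I -> {set V}) :
    Prop :=
  [/\ tree F,
      forall v : V, exists i, v \in B i,
      forall u v : V, G u v -> exists i, (u \in B i) && (v \in B i) &
      forall (v : V) (i j : I), v \in B i -> v \in B j ->
        connect [rel x y | [&& F x y, v \in B x & v \in B y]] i j].

Definition width (I : finType) (B : I -> {set V}) : nat :=
  (\max_(i : I) #|B i|).-1.

Definition has_decomposition_of_width (t : nat) : Prop :=
  exists (I : finType) (F : rel I) (B : I -> {set V}),
    tree_decomposition F B /\ width B = t.

Lemma has_decomposition_ex : exists t, `[< has_decomposition_of_width t >].
Proof.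
exists (width (fun _ : unit => [set: V])); apply/asboolP.
exists unit, (fun _ _ => false), (fun=> [set: V]); split=> //; split.
- split; rewrite ?card_unit //; first by move=> [] []; exact: connect0.
  by move=> [|x [|y s]] //= /andP[].
- by move=> v; exists tt; rewrite inE.
- by move=> u v _; exists tt; rewrite !inE.
- by move=> v [] [] _ _; exact: connect0.
Qed.

Definition treewidth : nat := ex_minn has_decomposition_ex.

End Treewidth.

Section Shortcutting.
Variables (R : realType) (V : finType).
Implicit Types (T G : rel V) (w d : V -> V -> R).

Definition path_length d (u : V) (p : seq V) : R :=
  \sum_(l <- pairmap d u p) l.

Definition edge_lengths T w : Prop :=
  forall x y, T x y -> 0 < w x y /\ w x y = w y x.

Definition shortest_path_metric T w (u v : V) : R :=
  inf [set path_length w u p | p in [set p | simple_path T u v p]]%classic.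

Definition shortcutting T w (k : nat) G : Prop :=
  simple_graph G /\
  forall u v : V, exists p : seq V,
    [/\ simple_path G u v p, (size p <= k)%N &
        path_length (shortest_path_metric T w) u p
          = shortest_path_metric T w u v].

End Shortcutting.

Definition path_graph (n : nat) : rel 'I_n :=
  fun i j => (i.+1 == j :> nat) || (j.+1 == i :> nat).

(* [ln] is 0 on nonpositive reals; hence [log2 (log2 1) = 0]. *)
Definition log2 {R : realType} (x : R) : R := ln x / ln 2.

(* Main.v *)
(* Bramble orders replace treewidth: a bramble of the quotient by connected
   fibers lifts, and if every vertex of a block has a neighbour in a connected
   set disjoint from it, adding that set to a bramble of the block raises its
   order. Let [N k s] be the largest length of a path admitting a shortcutting
   with at most [k] hops and bramble order at most [s]. Cut the path into blocks
   of length [N k s.-1 + 1]. Every block has a vertex without neighbours to the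
   right of the block and one without neighbours to its left, for otherwise the
   block would have bramble order at most [s.-1]. A [k]-hop path leaving a block
   from the former and entering another one at the latter spends its first and
   last edges inside the blocks, so contracting the blocks leaves at most [k - 2]
   hops. Hence [N k s + 1 <= (N k s.-1 + 1) * (N (k - 2) s + 1)], and Pascal's
   rule bounds [n] by [b ^ 'C(k./2 + t, k./2)], where [t] is the treewidth and [b]
   comes from the cases of 0 and 1 hops. The estimates follow from
   ['C(h + t, h) <= (1 + x) ^ h * (1 + 1 / x) ^ t] for suitable [x]. *)

Require Import Defs.
From mathcomp Require Import all_boot all_order all_algebra.
From mathcomp Require Import all_classical all_reals sequences exp.
From mathcomp Require Import ring lra.
Import Order.TTheory GRing.Theory Num.Theory.
Local Open Scope ring_scope.

Set Implicit Arguments.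
Unset Strict Implicit.

(** * Brambles and bounds on their order *)

Section Brambles.
Variables (V : finType) (e : rel V).
Implicit Types (A B H : {set V}) (S : {set {set V}}).

Definition induced_rel A : rel V := [rel x y | [&& e x y, x \in A & y \in A]].

Definition connected_set A : Prop :=
  forall x y, x \in A -> y \in A -> connect (induced_rel A) x y.

Definition touching A B : Prop :=
  exists x y, [/\ x \in A, y \in B & (x == y) || e x y].

(** The case [A = B] of the second clause makes every member nonempty. *)
Definition bramble S : Prop :=
  (forall A, A \in S -> connected_set A) /\
  (forall A B, A \in S -> B \in S -> touching A B).

Definition hitting_set S H : Prop :=
  forall A, A \in S -> exists2 x, x \in H & x \in A.

Definition bramble_order_le s : Prop :=
  forall S, bramble S -> exists2 H : {set V}, (#|H| <= s)%N & hitting_set S H.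

End Brambles.

(** Induction on a walk: the indices attached to one vertex are linked by [c], and each edge links
    an index of one end to an index of the other. It serves for preimages, images and bags alike. *)
Lemma chain_connect (V J : finType) (e : rel V) (c : rel J)
    (P : V -> pred J) :
  (forall x i j, P x i -> P x j -> connect c i j) ->
  (forall x y, e x y -> exists i j, [/\ P x i, P y j & connect c i j]) ->
  forall x y, connect e x y ->
  forall i j, P x i -> P y j -> connect c i j.
Proof.
move=> Pconn Padj x y /connectP[p].
elim: p x => [x _ -> i j|z p IHp x /= /andP[exz pzp] yE i j Pxi Pyj].
  exact: Pconn.
have [i' [j' [Pxi' Pzj' i'j']]] := Padj _ _ exz.
apply: (connect_trans (Pconn _ _ _ Pxi Pxi')).
by apply: (connect_trans i'j'); exact: IHp pzp yE _ _ Pzj' Pyj.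
Qed.

(** The preimages under [f] of the members of a bramble form a bramble of [e], and the [f]-image of
    a set hitting them hits the original members. *)
Lemma bramble_order_contraction (V W : finType) (e : rel V) (e' : rel W)
    (f : V -> W) s :
  (forall i, exists x, f x = i) ->
  (forall i, connected_set e (f @^-1: [set i])) ->
  (forall i j, e' i j -> exists x y, [/\ f x = i, f y = j & e x y]) ->
  bramble_order_le e s -> bramble_order_le e' s.
Proof.
move=> fsurj fconn fedge le_s S [Sconn Stouch].
pose S' := [set f @^-1: A | A : {set W} in S].
have [|H cardH hitH] := le_s S'; last first.
  exists (f @: H); first exact: leq_trans (leq_imset_card _ _) cardH.
  move=> A AS; have /hitH[x xH] : f @^-1: A \in S' by apply: imset_f.
  by rewrite inE; exists (f x); first exact: imset_f.
split=> [_ /imsetP[A AS ->] x y|_ _ /imsetP[A AS ->] /imsetP[B BS ->]].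
  rewrite !inE => fxA fyA.
  apply: (@chain_connect _ _ (induced_rel e' A) _
    (fun i x => (f x == i) && (i \in A)) _ _ (f x) (f y)); last 2 first.
  - by rewrite eqxx.
  - by rewrite eqxx.
  - move=> i u v /andP[/eqP fu iA] /andP[/eqP fv _].
    have /fconn uv : u \in f @^-1: [set i] by rewrite !inE fu.
    have {}/uv : v \in f @^-1: [set i] by rewrite !inE fv.
    apply: connect_sub => a b /and3P[eab].
    rewrite !inE => /eqP fa /eqP fb; apply: connect1.
    by rewrite /induced_rel /= eab !inE fa fb iA.
  - move=> i j /and3P[/fedge[u [v [<- <- euv]]] iA jA].
    exists u, v; rewrite !eqxx iA jA; split=> //.
    by apply: connect1; rewrite /induced_rel /= euv !inE iA jA.
  - exact: Sconn.
have [i [j [iA jB /orP[/eqP ij|/fedge]]]] := Stouch _ _ AS BS.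
  have [x fx] := fsurj i.
  by exists x, x; rewrite !inE fx eqxx {2}ij; split.
by move=> [x [y [fx fy exy]]]; exists x, y; rewrite !inE fx fy exy orbT; split.
Qed.

(** Every image under [g] of a member touches [Y], so [Y] may join the bramble of images. A hitting
    set must then spend a vertex in [Y], outside the range of [g], and pulling it back along [g]
    loses that vertex. *)
Lemma bramble_order_apex (V W : finType) (e : rel V) (e' : rel W)
    (g : W -> V) (Y : {set V}) s :
  symmetric e -> injective g -> (forall x y, e' x y -> e (g x) (g y)) ->
  connected_set e Y -> (exists y, y \in Y) -> (forall x, g x \notin Y) ->
  (forall x, exists2 y, y \in Y & e (g x) y) ->
  bramble_order_le e s.+1 -> bramble_order_le e' s.
Proof.
move=> esym ginj gedge Yconn [y0 y0Y] gY gadj le_s S [Sconn Stouch].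
pose S' := Y |: [set g @: A | A : {set W} in S].
have [|H cardH hitH] := le_s S'; last first.
  exists (g @^-1: H).
    have /hitH[z zH zY] : Y \in S' by rewrite !inE eqxx.
    rewrite -(card_imset _ ginj) -ltnS; apply: leq_trans cardH.
    apply/proper_card/properP; split.
      by apply/fintype.subsetP => _ /imsetP[x + ->]; rewrite inE.
    by exists z => //; apply/imsetP => -[x _ zx]; rewrite zx (negPf (gY x)) in zY.
  move=> A AS; have /hitH[z zH] : g @: A \in S' by rewrite inE imset_f ?orbT.
  by move=> /imsetP[x xA zx]; exists x; rewrite // inE -zx.
have Ytouch A : A \in S -> exists x y, [/\ x \in A, y \in Y & e (g x) y].
  move=> AS; have [x [_ [xA _ _]]] := Stouch _ _ AS AS.
  by have [y yY exy] := gadj x; exists x, y.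
split=> [A|A B].
  move=> /setU1P[->//|/imsetP[{}A AS ->] _ _ /imsetP[x xA ->] /imsetP[y yA ->]].
  apply: (@chain_connect _ _ (induced_rel e' A) _
    (fun x y => (x \in A) && (y == g x)) _ _ x y); last 2 first.
  - by rewrite xA eqxx.
  - by rewrite yA eqxx.
  - by move=> z i j /andP[_ /eqP->] /andP[_ /eqP->].
  - move=> a b /and3P[/gedge eab aA bA]; exists (g a), (g b).
    by rewrite aA bA !eqxx connect1 // /induced_rel /= eab !imset_f.
  - exact: Sconn.
move=> /setU1P[->|/imsetP[{}A AS ->]] /setU1P[->|/imsetP[{}B BS ->]].
- by exists y0, y0; rewrite eqxx.
- have [x [y [xB yY exy]]] := Ytouch _ BS.
  by exists y, (g x); rewrite esym exy orbT imset_f.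
- have [x [y [xA yY exy]]] := Ytouch _ AS.
  by exists (g x), y; rewrite exy orbT imset_f.
- have [x [y [xA yB /orP[/eqP xy|/gedge exy]]]] := Stouch _ _ AS BS.
    by exists (g x), (g y); rewrite xy eqxx -{1}xy !imset_f.
  by exists (g x), (g y); rewrite exy orbT !imset_f.
Qed.

(** * Brambles against tree decompositions *)

Lemma exists_fcycle_orbit (T : finType) (f : T -> T) (x0 : T) :
  exists x, fcycle f (fingraph.orbit f x).
Proof.
have /trajectP[i lt_i iter_i] := looping_order f x0.
exists (iter i f x0); apply/(orbitPcycle 3 0).
exists (order f x0 - i).-1%N; rewrite prednK ?subn_gt0 //.
by rewrite -iterD subnK // ltnW.
Qed.

(** Iterating [d] ends in a cycle, whose length is at most two by acyclicity and not one by
    irreflexivity. *)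
Lemma acyclic_neighbor_map (I : finType) (F : rel I) (d : I -> I) (i0 : I) :
  irreflexive F -> acyclic F -> (forall i, F i (d i)) ->
  exists i, d (d i) = i.
Proof.
move=> Firr Facyc Fd; have [i ic] := exists_fcycle_orbit d i0; exists i.
have /Facyc : ucycle F (fingraph.orbit d i).
  rewrite /ucycle orbit_uniq andbT; case: (fingraph.orbit d i) ic => //= a p.
  by apply: sub_path => x _ /eqP <-.
have : i \in fingraph.orbit d i by exact: in_orbit.
case: (fingraph.orbit d i) ic => [|a [|b [|? ?]]] //=.
  by rewrite andbT => /eqP da; have := Fd a; rewrite da Firr.
by case/and3P=> /eqP da /eqP db _; rewrite !inE => /orP[]/eqP-> _; rewrite ?da db ?da.
Qed.

Definition delete_edge (I : eqType) (F : rel I) i j : rel I :=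
  [rel x y | [&& F x y, (x, y) != (i, j) & (x, y) != (j, i)]].

(** A detour closed up by the edge would be a cycle with at least three vertices. *)
Lemma acyclic_no_detour (I : finType) (F : rel I) i j :
  simple_graph F -> acyclic F -> F i j -> ~~ connect (delete_edge F i j) i j.
Proof.
move=> [Fsym Firr] Facyc Fij; apply/negP => /connectP[p pathp lastp].
move: lastp; case/shortenP: pathp => {}p pathp uniqp _ lastp.
have /Facyc : ucycle F (i :: p).
  rewrite /ucycle uniqp andbT /= rcons_path -lastp Fsym Fij andbT.
  by apply: sub_path pathp => x y /and3P[].
case: p pathp lastp {uniqp} => [|x [|y p]] //=.
  by move=> _ ij; rewrite ij Firr in Fij.
by move=> /andP[/and3P[_ + _] _] xj; rewrite xj eqxx.
Qed.

(** The nodes whose bags meet a given member form a subtree, and any two such subtrees meet. If no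
    bag were hitting, each node would point towards a subtree avoiding it, and two adjacent nodes
    pointing at each other would be joined around their edge. *)
Lemma tree_decomposition_bramble (V : finType) (G : rel V) (I : finType)
    (F : rel I) (B : I -> {set V}) (S : {set {set V}}) :
  tree_decomposition G F B -> bramble G S -> exists i, hitting_set S (B i).
Proof.
move=> [[I0 [Fsym Firr] Fconn Facyc] Bcov Bedge Bconn] [Sconn Stouch].
pose T (A : {set V}) := [set i | [exists x in A, x \in B i]].
have Tconn A : A \in S -> connected_set F (T A).
  move=> /Sconn Aconn i j; rewrite !inE.
  move=> /exists_inP[x xA xi] /exists_inP[y yA yj].
  apply: (@chain_connect _ _ (induced_rel G A) _
    (fun x i => (x \in A) && (x \in B i)) _ _ x y); last 2 first.
  - by rewrite xA.
  - by rewrite yA.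
  - move=> z a b /andP[zA za] /andP[_ zb].
    apply: connect_sub (Bconn _ _ _ za zb) => c d /and3P[Fcd zc zd].
    apply: connect1; rewrite /induced_rel /= Fcd !inE /=.
    by apply/andP; split; apply/exists_inP; exists z.
  - move=> u v /and3P[Guv uA vA]; have [k /andP[uk vk]] := Bedge _ _ Guv.
    by exists k, k; rewrite uA vA.
  - exact: Aconn.
have Ttouch A A' : A \in S -> A' \in S -> exists i, i \in T A /\ i \in T A'.
  move=> AS AS'; have [x [y [xA yA /orP[/eqP xy|/Bedge[i /andP[xi yi]]]]]] :=
    Stouch _ _ AS AS'.
    have [i xi] := Bcov x; exists i; rewrite !inE.
    by split; apply/exists_inP; exists x; rewrite // xy.
  by exists i; rewrite !inE; split; apply/exists_inP; [exists x|exists y].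
apply: contrapT => nohit.
have missed i : exists A, A \in S /\ i \notin T A.
  apply: contrapT => H; apply: nohit; exists i => A AS.
  have : i \in T A by apply: contrapT => /negP iA; apply: H; exists A.
  by rewrite inE => /exists_inP[x xA xi]; exists x.
(* [j] is the first node on the way from [i] to the missed subtree. That subtree is connected and
   avoids [i], so all of it is reached from [j] without passing through [i]. *)
have towards i : exists j, F i j /\ exists2 A, A \in S /\ i \notin T A &
    forall z, z \in T A -> connect [rel x y | [&& F x y, x != i & y != i]] j z.
  have [A [AS iA]] := missed i; have [a [aA _]] := Ttouch _ _ AS AS.
  have /connectP[p pathp lastp] := Fconn i a.
  move: lastp; case/shortenP: pathp => -[|j p'] /=.
    by move=> _ _ _ ai; rewrite -ai aA in iA.
  move=> /andP[Fij pathp'] /andP[ip' _] _ lastp'.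
  exists j; split=> //; exists A => // z zA.
  apply: (@connect_trans _ _ a).
    apply/connectP; exists p' => //.
    apply: (sub_in_path (P := mem (j :: p')) (e := F)) pathp' => //; last exact/allP.
    move=> x y xp yp /= -> /=.
    by apply/andP; split; apply: contraNneq ip' => <-.
  apply: connect_sub (Tconn _ AS _ _ aA zA) => x y /and3P[Fxy xA yA].
  by apply: connect1; rewrite /= Fxy /=; apply/andP; split; apply: contraNneq iA => <-.
have /choice[d Fd] := towards.
have i0 : I by have /card_gt0P/cid[i _] := I0.
have [i ddi] := acyclic_neighbor_map i0 Firr Facyc (fun i => (Fd i).1).
have [Fij [A [AS iA] Aconn]] := Fd i.
have [Fji [A' [AS' jA'] Aconn']] := Fd (d i); rewrite ddi in Fji Aconn'.
have [z [zA zA']] := Ttouch _ _ AS AS'.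
have /negP := acyclic_no_detour (conj Fsym Firr) Facyc Fij; apply.
have Esym : connect_sym (delete_edge F i (d i)).
  apply: sym_connect_sym => x y; rewrite /delete_edge /= Fsym andbCA andbC -andbA.
  by rewrite !xpair_eqE ![(y == _) && _]andbC.
(* Each of the two walks to the common node [z] avoids one end of the edge, so neither uses it. *)
have iz : connect (delete_edge F i (d i)) i z.
  apply: connect_sub (Aconn' _ zA') => x y /and3P[Fxy xi yi]; apply: connect1.
  by rewrite /delete_edge /= Fxy !xpair_eqE negb_and yi orbT negb_and xi.
have jz : connect (delete_edge F i (d i)) (d i) z.
  apply: connect_sub (Aconn _ zA) => x y /and3P[Fxy xi yi]; apply: connect1.
  by rewrite /delete_edge /= Fxy !xpair_eqE !negb_and xi yi orbT.
by apply: (connect_trans iz); rewrite Esym.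
Qed.

Lemma treewidth_bramble_order (V : finType) (G : rel V) :
  bramble_order_le G (treewidth G).+1.
Proof.
move=> S brS; rewrite /treewidth; case: ex_minnP => t /asboolP[I [F [B [dec <-]]]] _.
have [i hit] := tree_decomposition_bramble dec brS.
exists (B i) => //; rewrite /width; apply: leq_trans (leqSpred _).
exact: (@leq_bigmax _ (fun i => #|B i|) i).
Qed.

(** * Graphs on an interval with few increasing hops *)

Definition increasing_edge n (e : rel 'I_n) : rel 'I_n :=
  [rel x y : 'I_n | (x < y)%N && e x y].

(** All that the recursion keeps of a shortcutting: shortest paths along a line are monotone, so the
    metric disappears. *)
Definition hop_le n k (e : rel 'I_n) : Prop :=
  forall u v : 'I_n, (u < v)%N -> exists p : seq 'I_n,
    [/\ path (increasing_edge e) u p, last u p = v & (size p <= k)%N].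

Definition convex n (A : {set 'I_n}) : Prop :=
  forall x y z : 'I_n, x \in A -> z \in A -> (x <= y <= z)%N -> y \in A.

Lemma increasing_path_le_last n (e : rel 'I_n) u p :
  path (increasing_edge e) u p -> (u <= last u p)%N.
Proof.
elim: p u => //= x p IHp u /andP[/andP[ux _] /IHp]; exact/leq_trans/ltnW.
Qed.

(** An increasing path stays between its end points, hence inside [A]. *)
Lemma convex_connected n k (e : rel 'I_n) (A : {set 'I_n}) :
  symmetric e -> hop_le k e -> convex A -> connected_set e A.
Proof.
move=> esym ehop Aconv.
have up x z : x \in A -> z \in A -> (x <= z)%N -> connect (induced_rel e A) x z.
  move=> xA zA; rewrite leq_eqVlt => /predU1P[/val_inj->//|/ehop[p [pathp lastp _]]].
  apply/connectP; exists p => //.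
  elim: p x xA pathp lastp => //= y p IHp x xA /andP[/andP[xy exy] pathp] lastp.
  have yA : y \in A.
    apply: (Aconv x y z) => //.
    by rewrite ltnW // -lastp (increasing_path_le_last pathp).
  by rewrite /induced_rel /= exy xA yA /=; exact: IHp.
move=> x z xA zA; have [|/ltnW zx] := leqP x z; first exact: up.
rewrite sym_connect_sym ?up // => a b.
by rewrite /induced_rel /= esym [(a \in A) && _]andbC.
Qed.

Lemma increasing_path_restrict n m b (e : rel 'I_n) (g : 'I_m -> 'I_n) u p :
  (forall x, g x = b + x :> nat)%N -> (last (g u) p < b + m)%N ->
  path (increasing_edge e) (g u) p ->
  exists2 q, path (increasing_edge (fun x y => e (g x) (g y))) u q & p = map g q.
Proof.
move=> gE; elim: p u => [|y p IHp] u /=; first by exists [::].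
move=> lt_last /andP[/andP[uy ey] pathp].
have b_le_y : (b <= y)%N by apply: leq_trans (ltnW uy); rewrite gE leq_addr.
have lt_y : (y - b < m)%N.
  rewrite ltn_subLR //; exact: leq_ltn_trans (increasing_path_le_last pathp) _.
have yE : y = g (Ordinal lt_y) by apply: val_inj; rewrite [RHS]gE /= subnKC.
rewrite yE in uy ey pathp lt_last *.
have [q pathq ->] := IHp _ lt_last pathp.
exists (Ordinal lt_y :: q) => //=.
by rewrite pathq /increasing_edge /= ey !andbT; move: uy; rewrite !gE ltn_add2l.
Qed.

Lemma hop_restrict n m b k (e : rel 'I_n) (g : 'I_m -> 'I_n) :
  (forall x, g x = b + x :> nat)%N ->
  hop_le k e -> hop_le k (fun x y => e (g x) (g y)).
Proof.
move=> gE ehop u v uv.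
have ginj : injective g.
  by move=> x y /(congr1 (@nat_of_ord n)); rewrite !gE => /addnI/val_inj.
have [|p [pathp lastp sizep]] := ehop (g u) (g v); first by rewrite !gE ltn_add2l.
have [|q pathq pE] := @increasing_path_restrict _ _ b e g u p gE _ pathp.
  by rewrite lastp gE ltn_add2l.
exists q; split=> //; last by move: sizep; rewrite pE size_map.
by apply: ginj; rewrite -last_map -pE.
Qed.

Lemma path_image (V W : eqType) (r : rel V) (r' : rel W) (f : V -> W) x p :
  (forall x y, r x y -> (f x == f y) || r' (f x) (f y)) -> path r x p ->
  exists q, [/\ path r' (f x) q, last (f x) q = f (last x p)
    & (size q <= size p)%N].
Proof.
move=> fr; elim: p x => [|y p IHp] x /=; first by exists [::].
move=> /andP[/fr xy /IHp[q [pathq lastq sizeq]]].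
case/orP: xy => [/eqP->|xy]; first by exists q; split=> //; exact: leqW.
by exists (f y :: q); rewrite /= xy.
Qed.

(* Otherwise contracting [Y] to an apex would leave the block with a bramble
   order smaller by one. *)
Lemma block_vertex_without_neighbor n a b k s (e : rel 'I_n) (Y : {set 'I_n}) :
  (0 < a)%N -> (b + a <= n)%N ->
  (forall e' : rel 'I_a, symmetric e' -> hop_le k e' -> ~ bramble_order_le e' s) ->
  symmetric e -> hop_le k e -> bramble_order_le e s.+1 ->
  convex Y -> (forall y, y \in Y -> ~~ (b <= y < b + a)%N) ->
  exists x : 'I_n, (b <= x < b + a)%N /\ forall y, y \in Y -> ~~ e x y.
Proof.
move=> a_gt0 ban small esym ehop eorder Yconv Yblock.
apply: contrapT => H.
have ltn_g (x : 'I_a) : (b + x < n)%N.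
  by apply: leq_trans ban; rewrite ltn_add2l.
pose g x := Ordinal (ltn_g x).
have gblock x : (b <= g x < b + a)%N by rewrite leq_addr ltn_add2l /=.
have gadj x : exists2 y, y \in Y & e (g x) y.
  apply: contrapT => Hx; apply: H; exists (g x); split=> // y yY.
  by apply/negP => exy; apply: Hx; exists y.
apply: (small (fun x y => e (g x) (g y))).
- by move=> x y; rewrite esym.
- exact: (@hop_restrict _ _ b).
apply: (@bramble_order_apex _ _ e _ g Y) eorder => //.
- by move=> x y /(congr1 val) /addnI/val_inj.
- exact: convex_connected ehop Yconv.
- by have [y yY _] := gadj (Ordinal a_gt0); exists y.
- by move=> x; apply/negP => /Yblock; rewrite gblock.
Qed.

(** The strict bounds [a] and [c] are what turns the recursion into a plain product. A block of [a]
    vertices has bramble order above [s] by the first smallness hypothesis, and the quotient by the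
    blocks is subject to the second. *)
Lemma hop_recursion k s a c :
  (0 < a)%N -> (0 < c)%N ->
  (forall m (e : rel 'I_m), symmetric e -> hop_le k.+2 e ->
     bramble_order_le e s -> (m < a)%N) ->
  (forall m (e : rel 'I_m), symmetric e -> hop_le k e ->
     bramble_order_le e s.+1 -> (m < c)%N) ->
  forall n (e : rel 'I_n), symmetric e -> hop_le k.+2 e ->
     bramble_order_le e s.+1 -> (n < c * a)%N.
Proof.
move=> a_gt0 c_gt0 small_a small_c n e esym ehop eorder.
rewrite -ltn_divLR //.
case qE : (n %/ a)%N => [//|q].
have qn : (q.+1 * a <= n)%N by rewrite -qE leq_divM.
(* The truncation at [q] adds the remainder of [n] modulo [a] to the last block. *)
pose f (x : 'I_n) : 'I_q.+1 := inord (minn (x %/ a)%N q).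
have fE x : f x = minn (x %/ a)%N q :> nat by rewrite inordK // ltnS geq_minr.
have fmono (x y : 'I_n) : (x <= y)%N -> (f x <= f y)%N.
  move=> xy; rewrite !fE leq_min geq_minr andbT (leq_trans (geq_minl _ _)) //.
  exact: leq_div2r.
have fblock (i : 'I_q.+1) (x : 'I_n) : (i * a <= x < i * a + a)%N -> f x = i.
  move=> /andP[ix xi]; apply: val_inj; rewrite [LHS]fE.
  have -> : (x %/ a = i)%N.
    apply/eqP; rewrite eqn_leq -ltnS ltn_divLR // leq_divRL // ix andbT.
    by rewrite mulSn addnC.
  by apply/minn_idPl; rewrite -ltnS.
have iblock (i : 'I_q.+1) : (i * a + a <= n)%N.
  by apply: leq_trans qn; rewrite addnC -mulSn leq_mul2r ltn_ord orbT.
pose e' i j := [exists x, exists y, [&& f x == i, f y == j & e x y]].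
have e'P i j : e' i j -> exists x y, [/\ f x = i, f y = j & e x y].
  by move=> /existsP[x /existsP[y /and3P[/eqP fx /eqP fy exy]]]; exists x, y.
apply: (small_c _ e').
- move=> i j; apply/idP/idP => /e'P[x [y [<- <- exy]]];
  by apply/existsP; exists y; apply/existsP; exists x; rewrite !eqxx esym.
- move=> i j ij.
  have small_e (e'' : rel 'I_a) :
      symmetric e'' -> hop_le k.+2 e'' -> ~ bramble_order_le e'' s.
    by move=> s1 h1 /(small_a _ _ s1 h1); rewrite ltnn.
  have [u [ui uadj]] : exists u : 'I_n, (i * a <= u < i * a + a)%N /\
      forall y, y \in [set y | (i < f y)%N] -> ~~ e u y.
    apply: block_vertex_without_neighbor small_e esym ehop eorder _ _ => //.
      move=> x y z; rewrite !inE => ix _ /andP[xy _].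
      exact: leq_trans ix (fmono _ _ xy).
    by move=> y; rewrite inE; apply: contraTN => /fblock->; rewrite ltnn.
  have [v [vj vadj]] : exists v : 'I_n, (j * a <= v < j * a + a)%N /\
      forall y, y \in [set y | (f y < j)%N] -> ~~ e v y.
    apply: block_vertex_without_neighbor small_e esym ehop eorder _ _ => //.
      move=> x y z; rewrite !inE => _ jz /andP[_ yz].
      exact: leq_ltn_trans (fmono _ _ yz) jz.
    by move=> y; rewrite inE; apply: contraTN => /fblock->; rewrite ltnn.
  move/fblock in ui; move/fblock in vj.
  have uv : (u < v)%N.
    by rewrite ltnNge; apply/negP => /fmono; rewrite ui vj leqNgt ij.
  have [[|x p] []] := ehop _ _ uv.
    by move=> _ uv_eq; rewrite -uv_eq ltnn in uv.
  move=> /= /andP[/andP[ux eux] pathp].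
  (* The path increases and [u] has no neighbour to the right of its block, so the first edge stays
     in the block. *)
  have fx : f x = i.
    apply: val_inj; apply/eqP; rewrite eqn_leq -{2}ui fmono ?(ltnW ux) // andbT.
    by rewrite leqNgt; apply: contraL eux => xi; apply: uadj; rewrite inE.
  (* An empty remainder would put [x = v] in two different blocks. Hence there is a last edge, which
     stays in the block of [v] by the choice of [v]. *)
  case/lastP: p pathp => [_ xv|p y].
    by rewrite -fx -vj -xv ltnn in ij.
  rewrite rcons_path /= last_rcons size_rcons => /andP[pathp /andP[zy ezy]] yv.
  rewrite {}yv in zy ezy; set z := last x p in zy ezy; rewrite !ltnS => sizep.
  have fz : f z = j.
    apply: val_inj; apply/eqP; rewrite eqn_leq -{1}vj fmono ?(ltnW zy) //=.
    by rewrite leqNgt; apply: contraL ezy => zj; rewrite esym vadj // inE.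
  have [|q' [pathq lastq sizeq]] :=
      @path_image _ _ _ (increasing_edge e') f _ _ _ pathp.
    move=> x' y' /andP[/ltnW/fmono + exy].
    rewrite leq_eqVlt => /predU1P[/val_inj->|f_lt]; first by rewrite eqxx.
    apply/orP; right; rewrite /increasing_edge /= f_lt; apply/existsP; exists x'.
    by apply/existsP; exists y'; rewrite !eqxx.
  by exists q'; rewrite -fx -fz (leq_trans sizeq).
apply: bramble_order_contraction e'P eorder => [i|i].
  have lt_i : (i * a < n)%N.
    by apply: leq_trans (iblock i); rewrite -[X in (X < _)%N]addn0 ltn_add2l.
  by exists (Ordinal lt_i); apply: fblock; rewrite /= leqnn -[X in (X < _)%N]addn0 ltn_add2l.
apply: convex_connected ehop _ => // x y z.
rewrite !inE => /eqP fx /eqP fz /andP[/fmono xy /fmono yz].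
by apply/eqP/val_inj/eqP; rewrite eqn_leq -{1}fz yz -fx.
Qed.

Lemma bramble_order0 m (e : rel 'I_m) : bramble_order_le e 0 -> m = 0%N.
Proof.
case: m e => // m e /(_ [set [set ord0]])[|H].
  split=> [A|A B]; rewrite !inE => /eqP->.
    by move=> x y; rewrite !inE => /eqP-> /eqP->.
  by move=> /eqP->; exists ord0, ord0; rewrite inE eqxx.
rewrite leqn0 => /eqP/cards0_eq-> /(_ [set ord0]) [|x]; first by rewrite inE eqxx.
by rewrite finset.in_set0.
Qed.

(** Double induction along Pascal's rule: exponents add as [hop_recursion] multiplies bounds. The
    cap [t0] allows one base [b] for all smaller [t], although the one-hop bound grows with [t]. *)
Lemma hop_bound k b t0 : (0 < b)%N ->
  (forall t n (e : rel 'I_n), (t <= t0)%N -> symmetric e -> hop_le k e ->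
     bramble_order_le e t.+1 -> (n < b)%N) ->
  forall h t n (e : rel 'I_n), (t <= t0)%N -> symmetric e ->
    hop_le (h.*2 + k) e -> bramble_order_le e t.+1 -> (n < b ^ 'C(h + t, h))%N.
Proof.
move=> b_gt0 base; elim=> [|h IHh]; first by move=> t n e; rewrite bin0 expn1; exact: base.
elim=> [|t IHt] n e t_le esym ehop eorder.
  (* Bramble order 0 forces an empty path, so the recursion runs with [a = 1]. *)
  rewrite addn0 binn expn1 -(muln1 b).
  apply: (hop_recursion _ b_gt0 _ _ esym ehop eorder) => // m e' e'sym.
    by move=> _ /bramble_order0->.
  move=> e'hop e'order; have := IHh 0%N m e' t_le e'sym e'hop e'order.
  by rewrite addn0 binn.
rewrite addnS binS addnC expnD addSnnS.
apply: (hop_recursion _ _ _ _ esym ehop eorder); rewrite ?expn_gt0 ?b_gt0 //.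
  by move=> m e' *; rewrite -addSnnS; apply: (IHt _ e') => //; exact: ltnW.
by move=> m e' *; apply: (IHh _ _ e').
Qed.

Lemma hop0_bound n (e : rel 'I_n) : hop_le 0 e -> (n < 2)%N.
Proof.
move=> ehop; rewrite ltnNge; apply/negP => n_ge2.
have [|p [_ + +]] := ehop (Ordinal (ltnW n_ge2)) (Ordinal n_ge2); first by [].
by case: p.
Qed.

(** With one hop all pairs are adjacent, so the singletons form a bramble that only the whole vertex
    set hits. *)
Lemma hop1_bound n (e : rel 'I_n) s :
  symmetric e -> hop_le 1 e -> bramble_order_le e s -> (n <= s)%N.
Proof.
move=> esym ehop /(_ [set [set x] | x in 'I_n]%SET)[|H cardH hitH].
  split=> [_ /imsetP[x _ ->] y z|_ _ /imsetP[x _ ->] /imsetP[y _ ->]].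
    by rewrite !inE => /eqP-> /eqP->.
  exists x, y; rewrite !inE; split=> //.
  wlog xy : x y / (x < y)%N => [sym_xy|].
    case: (ltngtP x y) => [|yx|/val_inj->]; first exact: sym_xy.
      by rewrite eq_sym esym sym_xy.
    by rewrite eqxx.
  have [[|z [|? ?]] [/= pathp lastp //]] := ehop _ _ xy.
    by rewrite lastp eqxx.
  by move: pathp; rewrite lastp /increasing_edge /= => /andP[/andP[_ ->]]; rewrite orbT.
apply: leq_trans cardH; rewrite -[leqLHS]card_ord; apply/subset_leq_card.
apply/fintype.subsetP => x _; have [|y yH] := hitH [set x]; first exact: imset_f.
by rewrite inE => /eqP <-.
Qed.

Lemma hop_bound_even n h t (e : rel 'I_n) : symmetric e -> hop_le h.*2 e ->
  bramble_order_le e t.+1 -> (n < 2 ^ 'C(h + t, h))%N.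
Proof.
move=> esym ehop; apply: (@hop_bound 0 _ t) => //; last by rewrite addn0.
by move=> t' m e' _ _ /hop0_bound.
Qed.

Lemma hop_bound_odd n h t (e : rel 'I_n) : symmetric e -> hop_le h.*2.+1 e ->
  bramble_order_le e t.+1 -> (n < t.+2 ^ 'C(h + t, h))%N.
Proof.
move=> esym ehop; apply: (@hop_bound 1 _ t) => //; last by rewrite addn1.
move=> t' m e' t_le e'sym e'hop /(hop1_bound e'sym e'hop) m_le.
by rewrite ltnS (leq_trans m_le).
Qed.

(** * Monotonicity of shortest paths in a weighted path *)

Section PathMetric.
Variables (R : realType) (n : nat) (w : 'I_n.+1 -> 'I_n.+1 -> R).
Hypothesis w_edge : edge_lengths (@path_graph n.+1) w.
Local Notation T := (@path_graph n.+1).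
Local Notation d := (shortest_path_metric T w).

(** The coordinate of [x] on the real line; [inord] stays in range because [j.+1 <= x]. *)
Definition position (x : 'I_n.+1) : R :=
  \sum_(j < x) w (inord j) (inord j.+1).

Lemma position_next (x y : 'I_n.+1) : x.+1 = y :> nat -> position y = position x + w x y.
Proof.
rewrite /position => xy; rewrite -xy big_ord_recr /=.
by congr (_ + w _ _); apply: val_inj; rewrite /= inordK // xy.
Qed.

Lemma position_ltn (x y : 'I_n.+1) : (x < y)%N -> position x < position y.
Proof.
elim: {y}(y : nat) {-2}y (erefl (y : nat)) => [|m IHm] y ym; first by rewrite ym.
have lt_m : (m < n.+1)%N by rewrite ltnW // -ym.
pose z : 'I_n.+1 := Ordinal lt_m.
have zy : z.+1 = y :> nat by rewrite ym.
have pos_zy : position z < position y.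
  have /w_edge[w_gt0 _] : T z y by rewrite /path_graph zy eqxx.
  by rewrite (position_next zy) ltrDl.
rewrite ym ltnS leq_eqVlt => /predU1P[xm|xm].
  by have -> : x = z by apply: val_inj.
by apply: lt_trans pos_zy; apply: IHm.
Qed.

Lemma edge_length_position x y : T x y -> w x y = `|position y - position x|.
Proof.
move=> Txy; have [w_gt0 w_sym] := w_edge Txy.
case/orP: Txy => /eqP /position_next ->.
  by rewrite addrAC subrr add0r gtr0_norm.
by rewrite -w_sym opprD addrA subrr add0r normrN gtr0_norm.
Qed.

Lemma path_length_position u p : path T u p ->
  `|position (last u p) - position u| <= path_length w u p.
Proof.
rewrite /path_length; elim: p u => [|x p IHp] u /=.
  by rewrite subrr normr0 big_nil.
move=> /andP[/edge_length_position wE /IHp le_p]; rewrite big_cons wE.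
by have := ler_distD (position x) (position (last x p)) (position u); lra.
Qed.

Lemma upward_path (u v : 'I_n.+1) : (u <= v)%N -> exists p,
  simple_path T u v p /\ path_length w u p = position v - position u.
Proof.
move=> uv; have [p [pathp lastp]] : exists p,
    path [rel x y : 'I_n.+1 | x.+1 == y :> nat] u p /\ last u p = v.
  elim: {v}(v : nat) {-2}v (erefl (v : nat)) uv => [|m IHm] v vm.
    rewrite vm leqn0 => /eqP u0; exists [::]; split=> //.
    by apply: val_inj; rewrite /= vm.
  rewrite leq_eqVlt => /predU1P[/val_inj->|]; first by exists [::].
  rewrite {1}vm ltnS => um.
  have lt_m : (m < n.+1)%N by rewrite ltnW // -vm.
  have [p [pathp lastp]] := IHm (Ordinal lt_m) erefl um.
  by exists (rcons p v); rewrite last_rcons rcons_path pathp lastp /= vm eqxx.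
exists p; split.
  rewrite /simple_path lastp eqxx; apply/and3P; split=> //.
    by apply: sub_path pathp => x y; rewrite /= /path_graph => ->.
  apply: (sorted_uniq (leT := relpre (@nat_of_ord _) ltn)).
  - by move=> y x z; exact: ltn_trans.
  - by move=> x; rewrite /= ltnn.
  - by apply: sub_path pathp => x y /= /eqP <-.
rewrite /path_length -{}lastp; elim: p u pathp {uv} => [|x p IHp] u /=.
  by rewrite subrr big_nil.
move=> /andP[/eqP /position_next ux /IHp]; rewrite big_cons => ->.
by rewrite ux opprD addrA [RHS]addrC; lra.
Qed.

Lemma metric_ge u v : `|position v - position u| <= d u v.
Proof.
apply: lb_le_inf.
  (* The lower bound on the infimum requires a nonempty set, so a simple path is exhibited. *)
  have [p sp] : exists p, simple_path T u v p.
    have : connect T u v.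
      wlog uv : u v / (u <= v)%N => [H|].
        have [|/ltnW] := leqP u v; first exact: H.
        move=> /H; rewrite sym_connect_sym // => x y.
        by rewrite /path_graph orbC.
      have [p [/and3P[pathp /eqP lastp _] _]] := upward_path uv.
      by apply/connectP; exists p.
    move=> /connectP[p pathp ->]; case/shortenP: pathp => q pathq uniqq _.
    by exists q; rewrite /simple_path pathq uniqq eqxx.
  by exists (path_length w u p); exists p.
by move=> _ [p /and3P[pathp /eqP <- _] <-]; exact: path_length_position.
Qed.

Lemma metric_le (u v : 'I_n.+1) : (u <= v)%N -> d u v <= position v - position u.
Proof.
move=> /upward_path[p [sp <-]]; apply: ge_inf; last by exists p.
by exists 0 => _ [q /and3P[pathq _ _] <-]; exact: le_trans (path_length_position pathq).
Qed.

Lemma metric_path_ge u p : position (last u p) - position u <= path_length d u p.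
Proof.
rewrite /path_length; elim: p u => [|x p IHp] u /=; first by rewrite subrr big_nil.
rewrite big_cons; have := metric_ge u x; have := ler_norm (position x - position u).
by have := IHp x; lra.
Qed.

(** Every edge is at least as long as its displacement in [position], and displacements telescope.
    Without excess length no edge goes backwards, and irreflexivity excludes stationary ones. *)
Lemma shortest_path_increasing (G : rel 'I_n.+1) u p : irreflexive G -> path G u p ->
  path_length d u p <= position (last u p) - position u ->
  path (increasing_edge G) u p.
Proof.
move=> Girr; elim: p u => //= x p IHp u /andP[Gux pathp].
rewrite /path_length /= big_cons -/(path_length d x p) => le_len.
have ge_p := metric_path_ge x p; have ge_x := metric_ge u x.
have abs_x := ler_norm (position x - position u).
rewrite IHp ?andbT //; last by lra.
rewrite /increasing_edge /= Gux andbT ltn_neqAle; apply/andP; split.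
  by apply: contraTneq Gux => /val_inj ->; rewrite Girr.
rewrite leqNgt; apply/negP => /position_ltn xu.
have : `|position x - position u| = position u - position x.
  by rewrite distrC gtr0_norm // subr_gt0.
by lra.
Qed.

Lemma shortcutting_hop k (G : rel 'I_n.+1) : shortcutting T w k G -> hop_le k G.
Proof.
move=> [[_ Girr] Gpath] u v uv; have [p [/and3P[pathp /eqP lastp _] sizep len]] := Gpath u v.
exists p; split=> //; apply: shortest_path_increasing => //.
by rewrite len lastp metric_le // ltnW.
Qed.

End PathMetric.

Lemma shortcutting_bound (R : realType) n k
    (w : 'I_n -> 'I_n -> R) (G : rel 'I_n) :
  edge_lengths (@path_graph n) w -> shortcutting (@path_graph n) w k G ->
  (n < (if odd k then (treewidth G).+2 else 2) ^ 'C(k./2 + treewidth G, k./2))%N.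
Proof.
case: n w G => [|n] w G w_edge GS; first by rewrite expn_gt0; case: ifP.
have Gsym := GS.1.1; have Ghop := shortcutting_hop w_edge GS.
have Gtw := @treewidth_bramble_order _ G.
move: Ghop; rewrite -{1}[k]odd_double_half; case: (odd k).
  by rewrite add1n => Ghop; exact: hop_bound_odd Gtw.
by rewrite add0n => Ghop; exact: hop_bound_even Gtw.
Qed.

(** * Upper bounds for binomial coefficients *)

Section Binomials.
Variable R : realType.
Implicit Types (h t : nat) (x : R).

(** Since [(1 + x) * (1 + x^-1) = (1 + x) + (1 + x^-1)], the right-hand side satisfies Pascal's rule
    with equality. *)
Lemma bin_le_prod h t x : 0 < x ->
  'C(h + t, h)%:R <= (1 + x) ^+ h * (1 + x^-1) ^+ t.
Proof.
move=> x_gt0; have x1 : 1 <= 1 + x by rewrite lerDl ltW.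
have x1' : 1 <= 1 + x^-1 by rewrite lerDl invr_ge0 ltW.
elim: h t => [|h IHh] t; first by rewrite bin0 expr0 mul1r exprn_ege1.
elim: t => [|t IHt]; first by rewrite addn0 binn expr0 mulr1 exprn_ege1.
rewrite addnS binS natrD; apply: le_trans (lerD IHt _) _.
  by rewrite addSnnS; exact: IHh.
rewrite !exprS le_eqVlt; apply/orP; left; apply/eqP.
by field; rewrite gt_eqF.
Qed.

(** Take [x = t / h] in the product bound and use [1 + h / t <= expR (h / t)]; the case [t = 0] is
    separate, as [x] must be positive. *)
Lemma bin_le_exp h t : (0 < h)%N ->
  'C(h + t, h)%:R <= (expR 1 * (1 + t%:R / h%:R)) ^+ h :> R.
Proof.
move=> h_gt0; have h0 : h%:R != 0 :> R by rewrite pnatr_eq0 -lt0n.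
have [->|t_gt0] := posnP t.
  rewrite addn0 binn mul0r addr0 mulr1 exprn_ege1 //.
  by have := expR_ge1Dx (1 : R); lra.
have t0 : t%:R != 0 :> R by rewrite pnatr_eq0 -lt0n.
apply: le_trans (bin_le_prod h t (x := t%:R / h%:R) _) _.
  by rewrite divr_gt0 ?ltr0n.
rewrite exprMn mulrC ler_wpM2r ?exprn_ge0 ?addr_ge0 ?divr_ge0 //.
have -> : expR 1 ^+ h = expR (t%:R / h%:R)^-1 ^+ t :> R.
  by rewrite -!expRM_natl mulr1; congr expR; field; rewrite h0 t0.
rewrite lerXn2r ?nnegrE ?expR_ge0 ?expR_ge1Dx //.
by rewrite addr_ge0 ?invr_ge0 ?divr_ge0.
Qed.

Lemma ln_bin_sqr h t : ln ('C(h + t, h)%:R : R) ^+ 2 <= 4 * h%:R * t%:R.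
Proof.
set X := ln _.
have C_ge1 : 1 <= 'C(h + t, h)%:R :> R by rewrite ler1n bin_gt0 leq_addr.
have : 0 <= X by exact: ln_ge0.
rewrite le_eqVlt => /predU1P[<-|X_gt0]; first by rewrite expr0n !mulr_ge0.
have h_gt0 : (0 < h)%N.
  by rewrite lt0n; apply: contraTneq X_gt0 => h0; rewrite /X h0 bin0 ln1 ltxx.
have h0 : 0 < h%:R :> R by rewrite ltr0n.
(* This [x] turns [X <= h * x + t / x] into [X <= X / 2 + 2 * h * t / X], which is the claim, and
   avoids the square root in the optimal [x]. *)
pose x := X / (2 * h%:R).
have x_gt0 : 0 < x by rewrite divr_gt0 ?mulr_gt0.
have ln_le (y : R) (m : nat) : 0 < y -> ln ((1 + y) ^+ m) <= m%:R * y.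
  move=> y_gt0; rewrite lnXn ?addr_gt0 // -[ln _ *+ _]mulr_natl ler_wpM2l // le_ln1Dx //.
  by apply: lt_trans y_gt0; rewrite ltrN10.
have pos (y : R) (m : nat) : 0 < y -> 0 < (1 + y) ^+ m.
  by move=> y_gt0; rewrite exprn_gt0 ?addr_gt0.
have xV_gt0 : 0 < x^-1 by rewrite invr_gt0.
have X_le : X <= h%:R * x + t%:R * x^-1.
  have : X <= ln ((1 + x) ^+ h * (1 + x^-1) ^+ t).
    by rewrite ler_ln ?posrE ?mulr_gt0 ?pos ?bin_le_prod // (lt_le_trans ltr01).
  rewrite lnM ?posrE ?pos // => /le_trans; apply.
  by rewrite lerD // ln_le.
have -> : X ^+ 2 = 2 * X * X - X * X by ring.
have : X * X <= X * (h%:R * x + t%:R * x^-1) by rewrite ler_pM2l.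
have -> : X * (h%:R * x + t%:R * x^-1) = X * X / 2 + 2 * h%:R * t%:R.
  by rewrite /x; field; rewrite !gt_eqF.
lra.
Qed.

End Binomials.

Lemma ltn_bin_add h t : (t < 'C(h.+1 + t, h.+1))%N.
Proof.
elim: t => [|t IHt]; first by rewrite addn0 binn.
rewrite addnS binS -[X in (X < _)%N]addn1 -[X in (X <= _)%N]addSn.
by rewrite leq_add // bin_gt0 addSnnS leq_addr.
Qed.

(** * From binomial bounds to lower bounds on the treewidth *)

Section Logarithms.
Variable R : realType.

Lemma ln2_ge : 1 / 2 <= ln 2 :> R.
Proof.
have := @le_ln1Dx R (- (1 / 2)).
have -> : 1 + - (1 / 2) = 2^-1 :> R by field.
rewrite lnV ?posrE // => H; suff : - ln (2 : R) <= - (1 / 2) by lra.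
by apply: H; lra.
Qed.

Lemma ln2_le : ln 2 <= 1 :> R.
Proof. by have := @le_ln1Dx R 1; rewrite -[1 + 1]/(2 : R); apply; lra. Qed.

Lemma log2_le_expn (n b m : nat) : (0 < n)%N -> (n <= b ^ m)%N ->
  log2 (n%:R : R) <= m%:R * log2 b%:R.
Proof.
move=> n_gt0 n_le; have ln2_gt0 : 0 < ln 2 :> R by have := ln2_ge; lra.
rewrite /log2 mulrA ler_pM2r ?invr_gt0 //.
case: b n_le => [|b] n_le.
  case: m n_le => [|m] n_le; last by rewrite exp0n // leqNgt n_gt0 in n_le.
  by rewrite expn0 in n_le; rewrite mul0r ln_le0 // -[1]/(1%:R) ler_nat.
rewrite mulr_natl -lnXn ?ltr0n // ler_ln ?posrE ?exprn_gt0 ?ltr0n //.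
by rewrite -natrX ler_nat.
Qed.

Lemma powR_root_le (a y : R) h : (0 < h)%N -> 0 <= a -> 0 <= y ->
  a <= y ^+ h -> a `^ h%:R^-1 <= y.
Proof.
move=> h_gt0 a_ge0 y_ge0 a_le.
have -> : y = (y ^+ h) `^ h%:R^-1.
  by rewrite -powR_mulrn // -powRrM divff ?powRr1 // pnatr_eq0 -lt0n.
by rewrite ge0_ler_powR ?nnegrE ?invr_ge0 ?exprn_ge0.
Qed.

Section Bounds.
Variables (n k t : nat).
Hypothesis n_gt0 : (0 < n)%N.
Hypothesis n_lt : (n < (if odd k then t.+2 else 2) ^ 'C(k./2 + t, k./2))%N.
Local Notation L := (log2 (n%:R : R)).

Let ln2_gt0 : 0 < ln 2 :> R.
Proof. by have := ln2_ge; lra. Qed.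

(** In both parities [L] is at most [t.+1] times the binomial coefficient. Hence [ln L <= a + b]
    with [a ^+ 2 <= 4 * t] and [b ^+ 2 <= 4 * k./2 * t], and
    [(a + b) ^+ 2 <= 2 * a ^+ 2 + 2 * b ^+ 2]. *)
Lemma ln_log2_sqr_le : ln L ^+ 2 <= 8 * k%:R * t%:R.
Proof.
have rhs_ge0 : 0 <= 8 * k%:R * t%:R :> R by rewrite !mulr_ge0.
(* For [n = 1] the default value [ln 0 = 0] makes the left-hand side vanish. *)
case: (leqP n 1) => [n_le1|n_gt1].
  have -> : n = 1%N by apply/eqP; rewrite eqn_leq n_le1.
  by rewrite /log2 ln1 mul0r ln0 // expr0n.
have L_ge1 : 1 <= L.
  by rewrite /log2 ler_pdivlMr // mul1r ler_ln ?posrE ?ltr0n // ler_nat.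
have k_gt0 : (0 < k)%N.
  rewrite lt0n; apply/eqP => k0; move: n_lt n_gt1.
  by rewrite k0 bin0 expn1 /= ltnS => n_le1; rewrite ltnNge n_le1.
have C_gt0 : 0 < 'C(k./2 + t, k./2)%:R :> R by rewrite ltr0n bin_gt0 leq_addr.
have L_le : L <= t.+1%:R * 'C(k./2 + t, k./2)%:R.
  have : (n <= 2 ^ (t.+1 * 'C(k./2 + t, k./2)))%N.
    rewrite expnM; apply: leq_trans (ltnW n_lt) _.
    rewrite leq_exp2r ?bin_gt0 ?leq_addr //.
    by case: ifP => _; [exact: ltn_expl | rewrite -[X in (X <= _)%N]expn1 leq_exp2l].
  move=> /(log2_le_expn n_gt0); rewrite natrM.
  by rewrite [log2 2%:R]/log2 divff ?gt_eqF // mulr1.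
have ln_le : ln L <= ln (t.+1%:R : R) + ln ('C(k./2 + t, k./2)%:R : R).
  have rhs_gt0 : 0 < t.+1%:R * 'C(k./2 + t, k./2)%:R :> R by exact: mulr_gt0.
  rewrite -lnM ?posrE //.
  by rewrite ler_ln ?posrE // (lt_le_trans ltr01).
have a_le := @ln_bin_sqr R 1 t; rewrite bin1 add1n mulr1 in a_le.
have b_le := @ln_bin_sqr R k./2 t.
have ln_ge : 0 <= ln L by exact: ln_ge0.
have hk : k./2%:R + 1 <= k%:R :> R.
  by rewrite -[1]/(1%:R) -natrD addn1 ler_nat -divn2 ltn_Pdiv.
have ht : (k./2%:R + 1) * t%:R <= k%:R * t%:R :> R by rewrite ler_wpM2r.
set a := ln t.+1%:R in ln_le a_le.
set b := ln 'C(k./2 + t, k./2)%:R in ln_le b_le.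
have ab_ge := sqr_ge0 (a - b).
have : ln L ^+ 2 <= (a + b) ^+ 2 by rewrite lerXn2r ?nnegrE //; lra.
rewrite !expr2 in ab_ge a_le b_le *; lra.
Qed.

Hypothesis k_gt0 : (0 < k)%N.
Hypothesis k_le : k%:R <= 2 / ln (2 * expR 1) * ln L.

Let k_pos : 0 < k%:R :> R.
Proof. by rewrite ltr0n. Qed.

Lemma ln_log2_ge : 3 / 4 * k%:R <= ln L.
Proof.
have ln2e : ln (2 * expR 1) = ln 2 + 1 :> R.
  by rewrite lnM ?posrE ?expR_gt0 // expRK.
move: k_le; rewrite ln2e mulrAC ler_pdivlMr; last by have := ln2_gt0; lra.
have := ln2_ge; set l := ln 2 => l_ge kl.
have : k%:R * (3 / 2) <= k%:R * (l + 1) by rewrite ler_pM2l //; lra.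
by lra.
Qed.

(** In this range [k / 2 <= ln L], which is compared with [ln L ^+ 2 <= 8 * k * t]. The result
    absorbs the summand [k] of the later estimates into [t]. *)
Lemma hops_le_treewidth : k%:R <= 32 * t%:R :> R.
Proof.
have := ln_log2_sqr_le; have := ln_log2_ge => ln_ge sqr_le.
have half_le : k%:R / 2 <= ln L by have := k_pos; lra.
have : (k%:R / 2) ^+ 2 <= ln L ^+ 2.
  by rewrite lerXn2r ?nnegrE ?divr_ge0 // (le_trans _ half_le) ?divr_ge0.
move=> /le_trans /(_ sqr_le).
have -> : (k%:R / 2) ^+ 2 = k%:R * (k%:R / 4) :> R by field.
have -> : 8 * k%:R * t%:R = k%:R * (8 * t%:R) :> R by ring.
by rewrite ler_pM2l //; lra.
Qed.

Lemma log2_gt1 : 1 < L.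
Proof.
rewrite ltNge; apply/negP => /ln_le0; have := ln_log2_ge; have := k_pos; lra.
Qed.

(** With [h = k./2], the [h]-th root of [L <= (e * (1 + t / h)) ^+ h], multiplied by [k = 2 * h],
    gives [e * (k + 2 * t)]; then [k <= 32 * t] applies. *)
Lemma even_hops_bound : ~~ odd k ->
  k%:R * L `^ (2 / k%:R) <= 34 * expR 1 * t%:R.
Proof.
move=> k_even; have kE : k%:R = 2 * k./2%:R :> R.
  by rewrite -{1}[k]odd_double_half (negPf k_even) add0n -muln2 natrM mulrC.
have h_gt0 : (0 < k./2)%N by move: k_even k_gt0; case: (k) => [|[]].
have h_pos : 0 < k./2%:R :> R by rewrite ltr0n.
have L_le : L <= 'C(k./2 + t, k./2)%:R.
  move: n_lt; rewrite (negPf k_even) => /ltnW /(log2_le_expn n_gt0).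
  by rewrite [log2 2%:R]/log2 divff ?gt_eqF // mulr1.
have e_gt0 := expR_gt0 (1 : R).
have -> : 2 / k%:R = k./2%:R^-1 :> R by rewrite kE; field; rewrite gt_eqF.
have : L `^ k./2%:R^-1 <= expR 1 * (1 + t%:R / k./2%:R).
  apply: powR_root_le => //.
  - by have := log2_gt1; lra.
  - by rewrite mulr_ge0 ?addr_ge0 ?divr_ge0 // ltW.
  - exact: le_trans L_le (bin_le_exp _ _ h_gt0).
rewrite -(ler_pM2l k_pos) => /le_trans; apply.
have -> : k%:R * (expR 1 * (1 + t%:R / k./2%:R)) =
    expR 1 * (k%:R + 2 * t%:R) :> R.
  by rewrite kE; field; rewrite gt_eqF.
rewrite -mulrA [X in _ <= X]mulrCA ler_pM2l //.
by have := hops_le_treewidth; lra.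
Qed.

(** If [L <= t], the binomial coefficient alone is at least [L]. Otherwise [t + 2 <= L ^+ 2], so the
    factor [log2 t.+2] costs at most [2 * log2 L]. The constant 70 is [2 * 32 + 4 + 2]. *)
Lemma odd_hops_bound : odd k -> (3 <= k)%N ->
  k%:R * (L / log2 L) `^ (2 / (k%:R - 1)) <= 70 * expR 1 * t%:R.
Proof.
move=> k_odd k_ge3; have kE : k%:R = 1 + 2 * k./2%:R :> R.
  by rewrite -{1}[k]odd_double_half k_odd natrD -muln2 natrM mulrC.
have h_gt0 : (0 < k./2)%N by move: k_ge3; case: (k) => [|[]].
have h_pos : 0 < k./2%:R :> R by rewrite ltr0n.
have h_ge1 : 1 <= k./2%:R :> R by rewrite ler1n.
have L_gt1 := log2_gt1.
have lnL_ge : 9 / 4 <= ln L.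
  have : 3 <= k%:R :> R by rewrite ler_nat.
  by have := ln_log2_ge; lra.
have L_ge2 : 2 <= L.
  by rewrite -ler_ln ?posrE //; have := ln2_le; lra.
have LL_ge1 : 1 <= log2 L.
  by rewrite {1}/log2 ler_pdivlMr // mul1r; have := ln2_le; lra.
have C_ge1 : 1 <= 'C(k./2 + t, k./2)%:R :> R by rewrite ler1n bin_gt0 leq_addr.
have quot_le : L / log2 L <= 2 * 'C(k./2 + t, k./2)%:R.
  rewrite ler_pdivrMr; last by lra.
  have [L_le_t|t_lt_L] := leP L t%:R.
    have : t%:R <= 'C(k./2 + t, k./2)%:R :> R.
      by rewrite ler_nat ltnW //; case: (k./2) h_gt0 => // h _; exact: ltn_bin_add.
    move=> t_le_C; have : 2 * 'C(k./2 + t, k./2)%:R * 1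
        <= 2 * 'C(k./2 + t, k./2)%:R * log2 L by rewrite ler_wpM2l // mulr_ge0.
    by lra.
  have L_le : L <= 'C(k./2 + t, k./2)%:R * log2 t.+2%:R.
    by move: n_lt; rewrite k_odd => /ltnW /(log2_le_expn n_gt0).
  apply: le_trans L_le _; rewrite [2 * _]mulrC -mulrA ler_wpM2l //.
  rewrite /log2 mulrA ler_wpM2r ?invr_ge0 ?(ltW ln2_gt0) //.
  rewrite -/(log2 _) mulr_natl -lnXn; last by lra.
  rewrite ler_ln ?posrE ?exprn_gt0 ?ltr0n //; last by lra.
  rewrite -addn2 natrD expr2.
  have : 2 * L <= L * L by rewrite ler_wpM2r //; lra.
  by lra.
pose y : R := expR 1 * (1 + t%:R / k./2%:R).
have e_gt0 := expR_gt0 (1 : R).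
have y_ge0 : 0 <= y by rewrite mulr_ge0 ?addr_ge0 ?divr_ge0 // ltW.
have -> : 2 / (k%:R - 1) = k./2%:R^-1 :> R.
  by rewrite kE addrC addKr invfM mulrA divff ?mul1r ?pnatr_eq0.
have : (L / log2 L) `^ k./2%:R^-1 <= 2 * y.
  apply: powR_root_le => //.
  - by rewrite divr_ge0 //; lra.
  - by rewrite mulr_ge0.
  (* The factor 2 is absorbed in [2 ^+ k./2], so its root contributes at most 2. *)
  - apply: le_trans quot_le _; rewrite exprMn; apply: ler_pM => //.
      by rewrite -{1}[2]expr1 ler_eXn2l ?ltr1n.
    exact: bin_le_exp.
rewrite -(ler_pM2l k_pos) => /le_trans; apply.
have -> : k%:R * (2 * y) = expR 1 * (2 * k%:R + 4 * t%:R + 2 * (t%:R / k./2%:R)).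
  by rewrite /y kE; field; rewrite gt_eqF.
rewrite -mulrA [X in _ <= X]mulrCA ler_pM2l //.
have : t%:R / k./2%:R <= t%:R :> R by rewrite ler_pdivrMr // ler_peMr.
by have := hops_le_treewidth; lra.
Qed.

End Bounds.
End Logarithms.

Unset Implicit Arguments.

Theorem theorem1p2 (R : realType) :
  exists c : R, 0 < c /\
    forall (n k : nat) (w : 'I_n -> 'I_n -> R) (G : rel 'I_n),
      (1 <= n)%N ->
      edge_lengths (@path_graph n) w ->
      shortcutting (@path_graph n) w k G ->
      let log_n : R := log2 n%:R in
      let loglog_n : R := log2 log_n in
      let threshold : R := 2 / ln (2 * expR 1) * ln log_n in
      let tw : R := (treewidth G)%:R in
      (k%:R <= threshold ->
         (~~ odd k -> c * (k%:R * log_n `^ (2 / k%:R)) <= tw) /\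
         (odd k -> (3 <= k)%N ->
            c * (k%:R * (log_n / loglog_n) `^ (2 / (k%:R - 1))) <= tw)) /\
      (threshold < k%:R -> c * (loglog_n ^+ 2 / k%:R) <= tw).
Proof.
have e_ge1 : 1 <= expR 1 :> R by have := expR_ge1Dx (1 : R); lra.
have c_gt0 : 0 < 70 * expR 1 :> R by lra.
(* The odd case dictates the constant: the even case gives [34 * e] and the range of large [k] gives
   32. *)
exists (70 * expR 1)^-1; split; first by rewrite invr_gt0.
move=> n k w G n_gt0 w_edge GS /=.
have n_lt := shortcutting_bound w_edge GS; move: n_lt.
set t := treewidth G => n_lt.
have t_ge0 : 0 <= t%:R :> R by [].
have et_ge : t%:R <= expR 1 * t%:R :> R by rewrite ler_peMl.
rewrite ![(70 * expR 1)^-1 * _]mulrC !(ler_pdivrMr _ _ c_gt0).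
(* For [k = 0] the left-hand sides of the even case and of the last bound vanish, the latter by the
   convention [0^-1 = 0]. *)
have [k0|k_gt0] := posnP k.
  have rhs_ge0 : 0 <= t%:R * (70 * expR 1) :> R by rewrite mulr_ge0 // ltW.
  rewrite k0 invr0 !mulr0 !mul0r.
  by split=> [_|_]; [split=> [_|//] | ].
split=> [k_le|_].
  split=> [k_even|k_odd k_ge3].
    apply: le_trans (even_hops_bound n_gt0 n_lt k_gt0 k_le k_even) _; lra.
  apply: le_trans (odd_hops_bound n_gt0 n_lt k_gt0 k_le k_odd k_ge3) _; lra.
have k_pos : 0 < k%:R :> R by rewrite ltr0n.
rewrite ler_pdivrMr //; have sqr_le := @ln_log2_sqr_le R _ _ _ n_gt0 n_lt.
have ln2_ge := ln2_ge R.
set l := ln (log2 n%:R) in sqr_le *.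
have -> : log2 (log2 n%:R) ^+ 2 = l ^+ 2 * (ln 2)^-2 :> R by rewrite /log2 exprMn exprVn.
(* The factor 4 bounds [(ln 2)^-2], as [ln 2 >= 1 / 2]. *)
have : l ^+ 2 * (ln 2)^-2 <= 8 * k%:R * t%:R * 4.
  apply: ler_pM => //; first by rewrite sqr_ge0.
    by rewrite invr_ge0 sqr_ge0.
  rewrite -[4]invrK lef_pV2 ?posrE ?invr_gt0 ?exprn_gt0 //; last by lra.
  have -> : 4^-1 = (1 / 2) ^+ 2 :> R by field.
  by rewrite lerXn2r ?nnegrE //; lra.
have : t%:R * k%:R <= expR 1 * t%:R * k%:R :> R by rewrite ler_wpM2r // ltW.
have : 0 <= t%:R * k%:R :> R by rewrite mulr_ge0.
by lra.
Qed.
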